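(* Let $(X,\mathcal{A},\mu)$ be a charge space and let $f : X \rightarrow \mathbb{R}$ be a function. Then the following three statements are logically equivalent. 1. $f \in L_0(X,\mathcal{A},\mu)$, i.e. $f$ is $T_1$-measurable. 2. $f$ satisfies the following: (a) there exists a countable set $C \subset \mathbb{R}$ such that $f^{-1}(y,\infty) \in \overline{\mathcal{A}}$ for all $y \in \mathbb{R} \setminus C$; and (b) $f$ is smooth. 3. There exist sequences $\{ f^+_n \}_{n=1}^{\infty}$ and $\{ f^-_n \}_{n=1}^{\infty}$ of simple functions with respect to $\overline{\mathcal{A}}$ such that for each $n \in \mathbb{N}$, \[ f^+_n = \sum_{j=1}^{K_n-1} y_{n,j} I_{(f^+)^{-1}(y_{n,j},y_{n,j+1}]} + y_n I_{(f^+)^{-1}(y_n,\infty)}, \qquad f^-_n = \sum_{j=1}^{K_n-1} y_{n,j} I_{(f^-)^{-1}(y_{n,j},y_{n,j+1}]} + y_n I_{(f^-)^{-1}(y_n,\infty)}, \] where (a) $K_n := n2^n$; (b) $y_{n,j} \in ((j-1)2^{-n}, j2^{-n}]$ for each $n \in \mathbb{N}$ and $j \in \{ 1, \ldots, K_n \}$, with $y_n := y_{n,K_n}$; (c) $(f^+)^{-1}(y_{n,j},\infty) \in \overline{\mathcal{A}}$ and $(f^-)^{-1}(y_{n,j},\infty) \in \overline{\mathcal{A}}$ for all $n \in \mathbb{N}$ and $j \in \{ 1, \ldots, K_n \}$; (d) $\{ y_{n,j} \}_{j=1}^{K_n} \subset \{ y_{n+1,j} \}_{j=1}^{K_{n+1}}$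 for each $n \in \mathbb{N}$; (e) $f^+_n \to f^+$ hazily and $f^-_n \to f^-$ hazily (with respect to $\mathcal{A}$) as $n \rightarrow \infty$.
   Context: A field $\mathcal{A}$ of subsets of a set $X$ is a collection containing $\emptyset$ and closed under complements and finite unions. A charge $\mu$ on $\mathcal{A}$ is a function $\mu:\mathcal{A}\to[0,\infty)$ with $\mu(\emptyset)=0$ and $\mu(A\cup B)=\mu(A)+\mu(B)$ for disjoint $A,B\in\mathcal{A}$ (all charges are non-negative and bounded, $\mu(X)<\infty$). Then $(X,\mathcal{A},\mu)$ is a charge space. Outer charge: $\mu^*(A):=\inf\{\mu(B): B\in\mathcal{A}, A\subseteq B\}$ for $A\subseteq X$. A sequence $f_n:X\to\mathbb{R}$ converges hazily to $f:X\to\mathbb{R}$ (with respect to $\mathcal{A}$) if for every $\epsilon>0$, $\mu^*(\{x:|f_n(x)-f(x)|>\epsilon\})\to 0$ as $n\to\infty$. A simple function (with respect to a field) is a function $\sum_{k=1}^K c_kI_{A_k}$ with $K \in \mathbb{N}$, $c_k\in\mathbb{R}$ and $\{A_1,\dots,A_K\}$ a partition of $X$ into sets of that field; $I_A$ is the indicator function of $A$. A function $f:X\to\mathbb{R}$ is $T_1$-measurable if some sequence of simple functions (with respect to $\mathcal{A}$) converges hazily to $f$; $L_0(X,\mathcal{A},\mu)$ is the set of $T_1$-measurable functions. $f$ is smooth if for every $\epsilon>0$ there is $k>0$ with $\mu^*(\{x:|f(x)|>k\})<\epsilon$. The Peano-Jordan completion of $\mathcal{A}$ is the field $\overline{\mathcal{A}}:=\{A\subseteq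 X:\forall\epsilon>0\ \exists B,C\in\mathcal{A}, B\subseteq A\subseteq C, \mu(C\setminus B)<\epsilon\}$. Notation: $f^+:=\max\{f,0\}$, $f^-:=\max\{-f,0\}$; $f^{-1}(a,b]$ denotes the inverse image of the interval $(a,b]$, and similarly for other intervals; $\mathbb{N}$ excludes $0$. *)

(* Defs.v *)
From mathcomp Require Export all_boot all_order all_algebra.
From mathcomp Require Export all_classical all_reals all_analysis.
Export Order.TTheory GRing.Theory Num.Theory.
Export numFieldNormedType.Exports.

Set Implicit Arguments.
Unset Strict Implicit.
Unset Printing Implicit Defensive.

Local Open Scope classical_set_scope.
Local Open Scope ring_scope.

(* The algebraOfSetsType structure attaches a single algebra to a pointed
   type.  Here X carries both a field and its completion, and X may be empty,
   so fields are plain families of sets.  Likewise charges are real-valued set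
   functions rather than extended-real-valued contents on such a type. *)
Definition is_field_of_sets (X : Type) (A : set (set X)) : Prop :=
  [/\ A set0, setC_closed A & setU_closed A].

(* A charge is only meaningful on A; its values off A are never used. *)
Definition is_charge (R : realType) (X : Type) (A : set (set X))
    (mu : set X -> R) : Prop :=
  [/\ mu set0 = 0,
      forall B, A B -> 0 <= mu B
    & forall B C, A B -> A C -> B `&` C = set0 ->
        mu (B `|` C) = mu B + mu C].

(* When A is a field and mu a charge, the set is nonempty (it contains mu setT)
   and bounded below by 0, so this is a genuine infimum. *)
Definition outer_charge (R : realType) (X : Type) (A : set (set X))
    (mu : set X -> R) (E : set X) : R :=
  inf [set mu B | B in [set B | A B /\ E `<=` B]].

Definition hazy_cvg (R : realType) (X : Type) (A : set (set X))
    (mu : set X -> R) (f_ : nat -> X -> R) (f : X -> R) : Prop :=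
  forall e : R, 0 < e ->
    outer_charge A mu [set x | e < `|f_ n x - f x|] @[n --> \oo] --> (0 : R).

(* The blocks of the partition may be empty, so that an empty level set is
   allowed as a block and X itself may be empty. *)
Definition simple_function (R : realType) (X : Type) (F : set (set X))
    (g : X -> R) : Prop :=
  exists (K : nat) (c : 'I_K -> R) (P : 'I_K -> set X),
    [/\ (0 < K)%N,
        forall k, F (P k),
        trivIset setT P,
        cover setT P = setT
      & g = fun x => \sum_(k < K) c k * \1_(P k) x].

Definition L0 (R : realType) (X : Type) (A : set (set X))
    (mu : set X -> R) : set (X -> R) :=
  [set f | exists f_ : nat -> X -> R,
     (forall n, simple_function A (f_ n)) /\ hazy_cvg A mu f_ f].

Definition smooth (R : realType) (X : Type) (A : set (set X))
    (mu : set X -> R) (f : X -> R) : Prop :=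
  forall e : R, 0 < e ->
    exists2 k : R, 0 < k & outer_charge A mu [set x | k < `|f x|] < e.

Definition peano_jordan (R : realType) (X : Type) (A : set (set X))
    (mu : set X -> R) : set (set X) :=
  [set E | forall e : R, 0 < e -> exists B C : set X,
     [/\ A B, A C, B `<=` E, E `<=` C & mu (C `\` B) < e]].

(* The number of dyadic cells ](j - 1) 2^-n, j 2^-n] in ]0, n]. *)
Definition nlevels (n : nat) : nat := (n * 2 ^ n)%N.

(* Levels are indexed from 1: only y 1, ..., y K are used when 0 < K.  Where
   g <= y 1 the value is 0. *)
Definition level_sum (R : realType) (X : Type) (K : nat) (y : nat -> R)
    (g : X -> R) : X -> R :=
  fun x => \sum_(1 <= j < K) y j * \1_(g @^-1` `]y j, y j.+1]) x
           + y K * \1_(g @^-1` `]y K, +oo[) x.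

(* Main.v *)
(* (1) => (2): the function y |-> mu^*{f > y} is monotone, hence has countably
   many jumps, and a simple function hazily close to f shows that {f > y} is in
   the completion whenever y is not a jump.  (2) => (3): the same argument for
   {f >= y} makes all but countably many y > 0 admissible as levels for both
   f^+ and f^-, so an admissible level can be picked in every dyadic cell;
   smoothness of f controls the region above the top level.  (3) => (1): a
   simple function with respect to the completion agrees, off a set of small outer
   charge, with one with respect to A. *)
Require Import Defs.
From mathcomp Require Import ring lra zify.

Set Implicit Arguments.
Unset Strict Implicit.
Unset Printing Implicit Defensive.

Local Open Scope classical_set_scope.
Local Open Scope ring_scope.

(** * Closure properties of fields of sets *)

Section FieldOfSets.
Context (X : Type) (F : set (set X)) (hF : is_field_of_sets F).
Implicit Types B C : set X.

Lemma field_setC B : F B -> F (~` B).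
Proof. by case: hF => _ FC _; exact: FC. Qed.

Lemma field_setU B C : F B -> F C -> F (B `|` C).
Proof. by case: hF => _ _; exact. Qed.

Lemma field_setI B C : F B -> F C -> F (B `&` C).
Proof.
by move=> FB FC; rewrite -[_ `&` _]setCK setCI; apply/field_setC/field_setU;
  exact: field_setC.
Qed.

Lemma field_setD B C : F B -> F C -> F (B `\` C).
Proof. by move=> FB FC; rewrite setDE; apply/field_setI/field_setC. Qed.

Lemma field_setT : F setT.
Proof. by rewrite -setC0; apply: field_setC; case: hF. Qed.

Lemma field_bigsetU (I : Type) (s : seq I) (P : pred I) (B : I -> set X) :
  (forall i, P i -> F (B i)) -> F (\big[setU/set0]_(i <- s | P i) B i).
Proof.
move=> FB; elim/big_rec: _ => [|i C Pi FC]; first by case: hF.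
by apply: field_setU => //; exact: FB.
Qed.

(** Since [T] is finite, such a preimage is a finite union of fibres. *)
Lemma field_preimage (T : finType) (h : X -> T) :
  (forall t, F (h @^-1` [set t])) -> forall S : set T, F (h @^-1` S).
Proof.
move=> Fh S.
have -> : h @^-1` S = \big[setU/set0]_(t | t \in S) h @^-1` [set t].
  rewrite -bigcup_seq_cond; apply/seteqP; split => x /=.
    by move=> Sx; exists (h x) => //=; rewrite mem_index_enum mem_set.
  by case=> t /andP[_ /set_mem St] /= ->.
by apply: field_bigsetU.
Qed.

End FieldOfSets.

(** * Simple functions as finite labellings *)

Section SimpleFunctions.
Context (R : realType) (X : Type) (F : set (set X)) (hF : is_field_of_sets F).

(** A valued partition amounts to a finite labelling [h] with fibres in [F], followed by [c].
    Pairing labels or uniting fibres then replaces any handling of partitions. *)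
Lemma simple_functionP (g : X -> R) :
  simple_function F g <->
  exists (T : finType) (h : X -> T) (c : T -> R),
    (forall t, F (h @^-1` [set t])) /\ g = c \o h.
Proof.
split=> [[K [c [P [K0 FP tP cP ->]]]]|[T [h [c [Fh ->]]]]].
  have /choice[h hP] : forall x, exists k, P k x.
    move=> x; have [k _ Pkx] : cover setT P x by rewrite cP.
    by exists k.
  have hE k : h @^-1` [set k] = P k.
    apply/seteqP; split=> [x /= <- //|x Pkx /=].
    by apply: (tP (h x) k) => //; exists x.
  exists 'I_K, h, c; split=> [k|]; first by rewrite hE.
  apply/funext => x /=; rewrite (bigD1 (h x)) //= big1 => [|k kh].
    by rewrite indicE mem_set // mulr1 addr0.
  rewrite indicE memNset ?mulr0 // => Pkx.
  by move: kh; rewrite -hE in Pkx; rewrite Pkx eqxx.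
(* The extra label [None] has an empty fibre; it keeps the number of blocks positive when [T] is
   empty. *)
pose U : finType := option T.
exists #|U|, (fun k => oapp c 0 (enum_val k)),
  (fun k => (Some \o h) @^-1` [set enum_val k]).
split.
- by apply/card_gt0P; exists None.
- move=> k; case: (enum_val k) => [t|].
    rewrite (_ : _ @^-1` _ = h @^-1` [set t]) //.
    by apply/seteqP; split=> x /=; [case|move=> ->].
  by rewrite (_ : _ @^-1` _ = set0); [case: hF|apply/seteqP; split].
- by move=> i j _ _ [x [/= e1 e2]]; apply: enum_val_inj; rewrite -e1 -e2.
- apply/seteqP; split=> // x _; exists (enum_rank (Some (h x))) => //=.
  by rewrite enum_rankK.
apply/funext => x /=; rewrite (bigD1 (enum_rank (Some (h x)))) //= big1.
  by rewrite indicE mem_set /= enum_rankK //= mulr1 addr0.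
move=> k kh; rewrite indicE memNset ?mulr0 //= => e.
by move: kh; rewrite e enum_valK eqxx.
Qed.

Lemma simple_function_comp2 (op : R -> R -> R) (g1 g2 : X -> R) :
  simple_function F g1 -> simple_function F g2 ->
  simple_function F (fun x => op (g1 x) (g2 x)).
Proof.
move=> /simple_functionP[T1 [h1 [c1 [F1 ->]]]].
move=> /simple_functionP[T2 [h2 [c2 [F2 ->]]]].
apply/simple_functionP; exists (T1 * T2)%type, (fun x => (h1 x, h2 x)),
  (fun t => op (c1 t.1) (c2 t.2)); split=> // -[t1 t2].
rewrite (_ : _ @^-1` _ = h1 @^-1` [set t1] `&` h2 @^-1` [set t2]).
  exact: field_setI.
by apply/seteqP; split=> x /=; [case=> -> ->|case=> -> ->].
Qed.

Lemma simple_function_indic (a : R) (B : set X) :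
  F B -> simple_function F (fun x => a * \1_B x).
Proof.
move=> FB; apply/simple_functionP.
exists bool, (fun x => x \in B), (fun b : bool => a * b%:R); split => [[]|].
- rewrite (_ : _ @^-1` _ = B) //.
  by apply/seteqP; split=> x /=; [move/set_mem|move/mem_set].
- rewrite (_ : _ @^-1` _ = ~` B); first exact: field_setC.
  apply/seteqP; split=> x /=; first by move=> /negbT/negP xB /mem_set.
  by move=> xB; apply: memNset.
- by apply/funext => x; rewrite /= indicE.
Qed.

Lemma simple_function_sum (I : Type) (s : seq I) (P : pred I)
    (g : I -> X -> R) : (forall i, P i -> simple_function F (g i)) ->
  simple_function F (fun x => \sum_(i <- s | P i) g i x).
Proof.
move=> Fg.
have -> : (fun x => \sum_(i <- s | P i) g i x) = \sum_(i <- s | P i) g i.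
  by apply/funext => x; rewrite fct_sumE.
elim/big_rec: _ => [|i h Pi Fh].
  have := @simple_function_indic 0 set0; rewrite (_ : (fun=> _) = 0).
    by apply; case: hF.
  by apply/funext => x; rewrite mul0r.
by apply: (@simple_function_comp2 +%R) => //; exact: Fg.
Qed.

Lemma simple_function_superlevel (g : X -> R) (y : R) :
  simple_function F g -> F [set x | y < g x].
Proof.
move=> /simple_functionP[T [h [c [Fh ->]]]].
exact: (field_preimage hF Fh [set t | y < c t]).
Qed.

Lemma simple_function_bounded (g : X -> R) :
  simple_function F g -> exists2 M, 0 <= M & forall x, `|g x| <= M.
Proof.
move=> /simple_functionP[T [h [c [_ ->]]]].
exists (\sum_t `|c t|); first exact: sumr_ge0.
by move=> x; rewrite (bigD1 (h x)) //= lerDl sumr_ge0.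
Qed.

End SimpleFunctions.

(** * Charges, outer charges and the Peano-Jordan completion *)

Section Charge.
Context (R : realType) (X : Type) (A : set (set X)) (mu : set X -> R).
Hypotheses (hA : is_field_of_sets A) (hmu : is_charge A mu).
Implicit Types B C D E : set X.
Local Notation omu := (outer_charge A mu).

Lemma charge_setD B C : A B -> A C -> B `<=` C -> mu C = mu B + mu (C `\` B).
Proof.
case: hmu => _ _ muU aB aC BC.
rewrite -muU ?setDIK //; last exact: field_setD.
by rewrite setUC setDKU.
Qed.

Lemma le_charge B C : A B -> A C -> B `<=` C -> mu B <= mu C.
Proof.
move=> aB aC BC; rewrite (charge_setD aB aC BC) lerDl.
by case: hmu => _ + _; apply; exact: field_setD.
Qed.

Lemma charge_setU_le B C : A B -> A C -> mu (B `|` C) <= mu B + mu C.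
Proof.
move=> aB aC.
rewrite (charge_setD aB (field_setU hA aB aC) (@subsetUl _ B C)).
rewrite lerD2l le_charge //.
  by apply: field_setD => //; exact: field_setU.
by move=> x [[]].
Qed.

Lemma outer_charge_le E B : A B -> E `<=` B -> omu E <= mu B.
Proof.
move=> aB EB; apply: ge_inf; last by exists B.
by exists 0 => _ [C [aC _] <-]; case: hmu => _ + _; exact.
Qed.

Lemma outer_charge_ge E (r : R) :
  (forall B, A B -> E `<=` B -> r <= mu B) -> r <= omu E.
Proof.
move=> Er; apply: lb_le_inf => [|_ [C [aC EC] <-]]; last exact: Er.
by exists (mu setT), setT => //; split => //; exact: field_setT.
Qed.

Lemma outer_charge_lt E (r : R) : omu E < r ->
  exists B, [/\ A B, E `<=` B & mu B < r].
Proof.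
move=> /inf_lt[|_ [B [aB EB] <-] Br]; last by exists B.
by exists (mu setT), setT => //; split => //; exact: field_setT.
Qed.

Lemma outer_charge_ge0 E : 0 <= omu E.
Proof. by apply: outer_charge_ge => B aB _; case: hmu => _ + _; exact. Qed.

Lemma le_outer_charge D E : D `<=` E -> omu D <= omu E.
Proof.
move=> DE; apply: outer_charge_ge => B aB EB.
by apply: outer_charge_le => // x /DE/EB.
Qed.

Lemma outer_charge_setU_le D E : omu (D `|` E) <= omu D + omu E.
Proof.
apply/ler_addgt0Pr => e e0.
have e20 : 0 < e / 2 by rewrite divr_gt0.
have [B [aB DB Be]] : exists B, [/\ A B, D `<=` B & mu B < omu D + e / 2].
  by apply: outer_charge_lt; rewrite ltrDl.
have [C [aC EC Ce]] : exists C, [/\ A C, E `<=` C & mu C < omu E + e / 2].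
  by apply: outer_charge_lt; rewrite ltrDl.
have := outer_charge_le (field_setU hA aB aC) (setUSS DB EC).
have := charge_setU_le aB aC; lra.
Qed.

Lemma outer_charge_lt_setU (D B C : set X) (b c : R) :
  D `<=` B `|` C -> omu B < b -> omu C < c -> omu D < b + c.
Proof.
move=> /le_outer_charge DBC Bb Cc.
have := outer_charge_setU_le B C; lra.
Qed.

(** By additivity, the bound on the charge of the difference can be stated as a linear inequality
    between charges. *)
Lemma peano_jordanP E :
  (forall e, 0 < e -> exists B C,
    [/\ A B, A C, B `<=` E, E `<=` C & mu C < mu B + e]) ->
  peano_jordan A mu E.
Proof.
move=> H e /H[B [C [aB aC BE EC BC]]]; exists B, C; split => //.
have := charge_setD aB aC (subset_trans BE EC); lra.
Qed.

(** The inner set need only be in the completion, and the outer one may be arbitrary: shrinking [U]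
    and enlarging [V] to sets of [A] costs e/3 each, and the gap between outer charges takes the
    last e/3. *)
Lemma peano_jordan_sandwich E :
  (forall e, 0 < e -> exists U V, [/\ peano_jordan A mu U, U `<=` E, E `<=` V &
    omu V < omu U + e]) ->
  peano_jordan A mu E.
Proof.
move=> H; apply: peano_jordanP => e e0.
have e30 : 0 < e / 3 by rewrite divr_gt0.
have [U [V [PU UE EV UV]]] := H _ e30.
have [B [B' [aB aB' BU UB' BB']]] := PU _ e30.
have [C [aC VC Ce]] : exists C, [/\ A C, V `<=` C & mu C < omu V + e / 3].
  by apply: outer_charge_lt; rewrite ltrDl.
exists B, C; split => //; [exact: subset_trans UE|exact: subset_trans VC|].
have := charge_setD aB aB' (subset_trans BU UB').
have := outer_charge_le aB' UB'; lra.
Qed.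

Lemma peano_jordan_field : is_field_of_sets (peano_jordan A mu).
Proof.
have mu0 : mu set0 = 0 by case: hmu.
have A0 : A set0 by case: hA.
split.
- by move=> e e0; exists set0, set0; split => //; rewrite set0D mu0.
- move=> E PE e /PE[B [C [aB aC BE EC Ce]]]; exists (~` C), (~` B).
  split; [exact: field_setC|exact: field_setC|exact: subsetC|exact: subsetC|].
  by rewrite setDE setCK setIC -setDE.
- move=> D E PD PE e e0.
  have e20 : 0 < e / 2 by rewrite divr_gt0.
  have [B [C [aB aC BD DC Ce]]] := PD _ e20.
  have [B' [C' [aB' aC' BE' EC' Ce']]] := PE _ e20.
  exists (B `|` B'), (C `|` C').
  split; [exact: field_setU|exact: field_setU|exact: setUSS|exact: setUSS|].
  have := le_charge
    (field_setD hA (field_setU hA aC aC') (field_setU hA aB aB'))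
    (field_setU hA (field_setD hA aC aB) (field_setD hA aC' aB')).
  have := charge_setU_le (field_setD hA aC aB) (field_setD hA aC' aB').
  move=> h1 h2; suff /h2 : (C `|` C') `\` (B `|` B') `<=`
    (C `\` B) `|` (C' `\` B') by lra.
  by move=> x [[Cx|Cx] /not_orP[nB nB']]; [left|right].
Qed.

End Charge.

(** * Countable exceptional sets on the real line *)

Section RealLine.
Context (R : realType).

(** A countable set is Lebesgue-null, whereas a nonempty open interval has positive measure. *)
Lemma countable_setC_itv (C : set R) (a b : R) :
  countable C -> a < b -> exists y, [/\ a < y, y < b & ~ C y].
Proof.
move=> cC ab; apply: contrapT => H.
have cab : countable `]a, b[.
  apply: sub_countable cC; apply: subset_card_le => y /=.
  rewrite in_itv /= => /andP[ay yb]; apply: contrapT => Cy.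
  by apply: H; exists y.
have := countable_lebesgue_measure0 cab.
by rewrite lebesgue_measure_itv /= lte_fin ab -EFinB => -[] ; lra.
Qed.

(* The jump intervals of a monotone function are disjoint, so choosing a
   rational in each of them injects the set of jumps into the rationals. *)
Lemma countable_jumps (G : R -> R) :
  {homo G : x y / x <= y >-> y <= x} ->
  exists C : set R, countable C /\
    forall y, ~ C y -> forall e, 0 < e ->
      exists2 d, 0 < d & G (y - d) < G (y + d) + e.
Proof.
move=> Gmono.
(* A jump is witnessed by a rational strictly between all values to the right and all values to the
   left. *)
pose J : set R := [set y | exists q : rat, forall u v, u < y -> y < v ->
  G v < ratr q /\ ratr q < G u].
exists J; split.
  have /choice[q qP] : forall y, exists q : rat, J y -> forall u v,
      u < y -> y < v -> G v < ratr q /\ ratr q < G u.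
    move=> y; have [[q qP]|nJ] := pselect (J y); first by exists q.
    by exists 0.
  have lt_neq y z : J y -> J z -> y < z -> q y <> q z.
    (* The value of [G] at the midpoint is below the rational of y and above that of z. *)
    move=> Jy Jz yz qyz; have [ym mz] := midf_lt yz.
    have [+ _] := qP y Jy (y - 1) ((y + z) / 2) ltac:(lra) ym.
    have [_] := qP z Jz ((y + z) / 2) (z + 1) mz ltac:(lra).
    by rewrite qyz; lra.
  apply/countable_injP; exists (pickle \o q) => y z /set_mem Jy /set_mem Jz /=.
  move=> /(pcan_inj pickleK_inv) qyz; have [yz|yz|//] := ltgtP y z.
    by case: (lt_neq y z).
  by case: (lt_neq z y).
move=> y nJ e e0; apply: contrapT => H; apply: nJ.
(* If no d works, [G] drops by at least e across every symmetric interval around y, hence by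
   monotonicity across every interval around y. *)
have gap u v : u < y -> y < v -> G v + e <= G u.
  move=> uy yv; pose d := Num.min (y - u) (v - y).
  have d0 : 0 < d by rewrite lt_min !subr_gt0 uy yv.
  have [du dv] : d <= y - u /\ d <= v - y.
    by split; rewrite ge_min lexx ?orbT.
  move: d d0 du dv => d d0 du dv.
  have : G (y + d) + e <= G (y - d).
    rewrite leNgt; apply/negP => lt; apply: H.
    by exists d.
  have /Gmono : u <= y - d by lra.
  have /Gmono : y + d <= v by lra.
  lra.
pose V := [set G v | v in [set v | y < v]].
have V0 : V !=set0 by exists (G (y + 1)), (y + 1) => //=; lra.
have Vub u : u < y -> ubound V (G u - e).
  by move=> uy _ [v /= yv <-]; have := gap u v uy yv; lra.
have supV u : u < y -> sup V <= G u - e.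
  by move=> uy; apply: ge_sup => //; exact: Vub.
(* [sup V] is the right limit at y, and the left values are at least [sup V + e]. *)
have [q] : exists q : rat, ratr q \in `]sup V, (sup V + e)[.
  by apply: rat_in_itvoo; rewrite ltrDl.
rewrite in_itv /= => /andP[q1 q2]; exists q => u v uy yv; split.
  apply: le_lt_trans q1; apply: sup_ubound; last by exists v.
  by exists (G u - e); exact: Vub.
by have := supV u uy; lra.
Qed.

End RealLine.

(** * Hazy convergence and the consequences of T1-measurability *)

Section HazyConvergence.
Context (R : realType) (X : Type) (A : set (set X)) (mu : set X -> R).
Hypotheses (hA : is_field_of_sets A) (hmu : is_charge A mu).
Local Notation omu := (outer_charge A mu).

(** One number can serve both as threshold and as bound: given a threshold and a bound, take their
    minimum and use monotonicity of the outer charge. *)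
Lemma hazy_cvgP (f_ : nat -> X -> R) (f : X -> R) :
  hazy_cvg A mu f_ f <->
  forall e, 0 < e -> \forall n \near \oo, omu [set x | e < `|f_ n x - f x|] < e.
Proof.
split=> H e e0.
  have /cvgrPdist_lt/(_ e e0) := H e e0; apply: filterS => n.
  by rewrite sub0r normrN ger0_norm // outer_charge_ge0.
apply/cvgrPdist_lt => d d0; have m0 : 0 < Num.min e d by rewrite lt_min e0 d0.
have := H _ m0; apply: filterS => n.
rewrite sub0r normrN ger0_norm ?outer_charge_ge0 // => lt.
apply: le_lt_trans (lt_le_trans lt _); last by rewrite ge_min lexx orbT.
apply: le_outer_charge => // x /=; apply: le_lt_trans.
by rewrite ge_min lexx.
Qed.

(** Choosing an approximant for each e = 1/(n+1) recovers a sequence, so later arguments handle a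
    single simple function. *)
Lemma L0P (f : X -> R) : L0 A mu f <->
  forall e, 0 < e -> exists2 g, simple_function A g &
    omu [set x | e < `|g x - f x|] < e.
Proof.
split=> [[f_ [Sf /hazy_cvgP cf]] e e0|H].
  by have [n _ /(_ n (leqnn n)) fn] := cf e e0; exists (f_ n).
have /choice[f_ Hf] : forall n, exists g, simple_function A g /\
    omu [set x | n.+1%:R^-1 < `|g x - f x|] < n.+1%:R^-1.
  by move=> n; have [|g] := H n.+1%:R^-1; [rewrite invr_gt0|exists g].
exists f_; split=> [n|]; first by case: (Hf n).
apply/hazy_cvgP => e e0; near=> n.
have ne : n.+1%:R^-1 < e by near: n; exact: near_infty_natSinv_lt (PosNum e0).
have [_ lt] := Hf n; apply: le_lt_trans (lt_trans lt ne).
by apply: le_outer_charge => // x /=; apply: lt_trans.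
Unshelve. all: by end_near. Qed.

Lemma L0_sub (f g : X -> R) :
  L0 A mu f -> L0 A mu g -> L0 A mu (fun x => f x - g x).
Proof.
move=> /L0P Lf /L0P Lg; apply/L0P => e e0.
have e20 : 0 < e / 2 by rewrite divr_gt0.
have [f' Sf' Hf] := Lf _ e20; have [g' Sg' Hg] := Lg _ e20.
exists (fun x => f' x - g' x).
  exact: (@simple_function_comp2 _ _ _ hA (fun a b => a - b)).
rewrite [ltRHS](splitr e); apply: outer_charge_lt_setU Hf Hg => // x /= ex.
apply/orP; rewrite -[_ || _]negbK negb_or -!leNgt; apply/negP => /andP[hf hg].
have := ler_normB (f' x - f x) (g' x - g x).
rewrite (_ : _ - _ - _ = f' x - g' x - (f x - g x)); first by lra.
by ring.
Qed.

(** If |g| is bounded by M, then |f| > M + e forces |g - f| > e. *)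
Lemma L0_smooth (f : X -> R) : L0 A mu f -> smooth A mu f.
Proof.
move=> /L0P Lf e e0; have [g Sg Hg] := Lf e e0.
have [M M0 gM] := simple_function_bounded hA Sg.
exists (M + e); first by rewrite ltr_wpDl.
apply: le_lt_trans Hg; apply: le_outer_charge => // x /= Mx.
have := ler_normB (f x) (f x - g x); rewrite subKr distrC => h.
have := gM x; have := ler_normB (g x) (g x - f x); rewrite subKr; lra.
Qed.

(* [G] is constant up to e on a neighbourhood of y, and a simple function
   hazily close to f squeezes {f > y} between sets of A whose charges are
   close to the values of [G] there. *)
Lemma L0_superlevel (f : X -> R) : L0 A mu f ->
  exists C : set R, countable C /\
    forall y : R, ~ C y -> peano_jordan A mu (f @^-1` `]y, +oo[).
Proof.
move=> /L0P Lf; pose G y := omu [set x | y < f x].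
have [|C [cC CP]] := @countable_jumps _ G.
  move=> y z yz; apply: le_outer_charge => // x /=; exact: le_lt_trans.
exists C; split=> // y Cy; rewrite preimage_itvoy.
apply: peano_jordanP => // e e0.
have e80 : 0 < e / 8 by rewrite divr_gt0.
have [d d0 Gd] := CP y Cy _ e80.
(* The bound d/2 keeps a shift of the level by r plus an error of r within d. Four errors of e/8
   arise: the jump of [G], the choice of [D], and [N] counted twice. *)
have m0 : 0 < Num.min (d / 2) (e / 8) by rewrite lt_min e80 divr_gt0.
have [g Sg] := Lf _ m0; set r := Num.min _ _ in m0 *.
have [rd re] : r <= d / 2 /\ r <= e / 8 by split; rewrite ge_min lexx ?orbT.
move=> /(outer_charge_lt hA)[N [aN Ng Nr]].
have close x : ~ N x -> g x <= f x + r /\ f x <= g x + r.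
  move=> nN; have : `|g x - f x| <= r.
    by rewrite leNgt; apply/negP => lt; apply: nN; exact: Ng.
  by rewrite ler_norml => /andP[]; lra.
have aS z : A [set x | z < g x] := simple_function_superlevel hA z Sg.
pose lo := [set x | y + r < g x]; pose hi := [set x | y - r < g x].
(* Removing [N] from the inner set and adding it to the outer one turns closeness off [N] into
   genuine inclusions. *)
exists (lo `\` N), (hi `|` N).
have alo : A (lo `\` N) by apply: field_setD => //; exact: aS.
have ahi : A (hi `|` N) by apply: field_setU => //; exact: aS.
split=> //.
- by move=> x []; rewrite /lo /= => lox /close[]; lra.
- move=> x /= fx; have [Nx|/close[]] := pselect (N x); first by right.
  by left; rewrite /hi /=; lra.
have [D [aD fD De]] : exists D, [/\ A D, [set x | y - d < f x] `<=` D &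
    mu D < G (y - d) + e / 8].
  by apply: outer_charge_lt => //; rewrite ltrDl.
have hiD : hi `|` N `<=` D `|` N.
  move=> x []; [rewrite /hi /= => hix|by right].
  have [Nx|/close[gx _]] := pselect (N x); first by right.
  by left; apply: fD => /=; lra.
have Glo : G (y + d) <= mu ((lo `\` N) `|` N).
  apply: outer_charge_le (field_setU hA alo aN) _ => // x /= fx.
  have [Nx|nN] := pselect (N x); first by right.
  by left; split=> //; rewrite /lo /=; case: (close x nN); lra.
have := le_charge hA hmu ahi (field_setU hA aD aN) hiD.
have := charge_setU_le hA hmu aD aN.
have := charge_setU_le hA hmu alo aN.
lra.
Qed.

End HazyConvergence.

(** * Level sums and nested dyadic levels *)

Section LevelSums.
Context (R : realType) (X : Type).
Implicit Types (y : nat -> R) (g : X -> R).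

(** Each block is a difference of two superlevel sets, so only the latter need lie in [F]. *)
Lemma simple_function_level_sum (F : set (set X)) (K : nat) y g :
  is_field_of_sets F -> (0 < K)%N ->
  (forall j, (1 <= j <= K)%N -> F (g @^-1` `]y j, +oo[)) ->
  simple_function F (level_sum K y g).
Proof.
move=> hF K0 Fg; apply: (@simple_function_comp2 _ _ _ hF +%R); last first.
  by apply: simple_function_indic => //; apply: Fg; rewrite K0 leqnn.
under eq_fun do rewrite big_nat.
apply: simple_function_sum => // j /andP[j1 jK].
apply: simple_function_indic => //.
rewrite (_ : _ @^-1` _ = g @^-1` `]y j, +oo[ `\` g @^-1` `]y j.+1, +oo[).
  by apply: field_setD => //; apply: Fg; lia.
apply/seteqP; split=> x /=; rewrite !in_itv /= ?andbT.
  by move=> /andP[-> /=]; rewrite leNgt => /negP.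
by move=> [-> /negP]; rewrite -leNgt.
Qed.

(** Induction on the number of levels: a new top level changes the sum only where g exceeds it, and
    between the old and new tops the sum keeps the old top as its value. Above the top level the
    error has no bound, hence the two clauses. *)
Lemma level_sum_approx (K : nat) y g (d : R) (x : X) : (0 < K)%N ->
  0 <= y 1%N <= d ->
  (forall j, (1 <= j < K)%N -> y j <= y j.+1 <= y j + d) -> 0 <= g x ->
  (y K < g x -> level_sum K y g x = y K) /\
  (g x <= y K -> 0 <= g x - level_sum K y g x <= d).
Proof.
move=> + /andP[y0 yd] + gx; case: K => // K _; elim: K => [_|K IH step].
  rewrite /level_sum big_geq // add0r indicE; split=> gy.
    by rewrite mem_set ?mulr1 //= in_itv /= gy.
  by rewrite memNset /= ?in_itv /= ?andbT; [lra|apply/negP; rewrite -leNgt].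
have [j jK|IHlt IHle] := IH; first by apply: step; lia.
have /andP[yK yKd] := step K.+1 ltac:(lia).
pose s := \sum_(1 <= j < K.+1) y j * \1_(g @^-1` `]y j, y j.+1]) x.
have sE : level_sum K.+1 y g x = s + y K.+1 * (y K.+1 < g x)%R%:R.
  rewrite /level_sum -/s indicE; congr (_ + _ * _%:R); congr nat_of_bool.
  by apply/idP/idP; rewrite inE /= in_itv /= andbT.
have -> : level_sum K.+2 y g x =
    s + y K.+1 * (y K.+1 < g x <= y K.+2)%R%:R + y K.+2 * (y K.+2 < g x)%R%:R.
  rewrite /level_sum big_nat_recr //= -/s !indicE.
  congr (_ + _ * _%:R + _ * _%:R); congr nat_of_bool.
    by apply/idP/idP; rewrite inE /= in_itv.
  by apply/idP/idP; rewrite inE /= in_itv /= andbT.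
have [g1|g1] := ltP (y K.+1) (g x).
  (* Above the old top level the induction hypothesis forces [s] to vanish. *)
  have := IHlt g1; rewrite sE g1 /= mulr1 => s0.
  have [g2|g2] := ltP (y K.+2) (g x); rewrite ?mulr1 ?mulr0.
    by split; lra.
  by split; lra.
have := IHle g1; rewrite sE ltNge g1 /= mulr0 addr0.
have -> : (y K.+2 < g x) = false by apply/negP; lra.
by rewrite !mulr0 !addr0; split; lra.
Qed.

Definition dyadic_cell (n j : nat) : interval R :=
  `](j%:R - 1) * 2 ^- n, j%:R * 2 ^- n].

Lemma dyadic_cell_split (n j : nat) (r : R) : (0 < j)%N ->
  r \in dyadic_cell n j ->
  r \in dyadic_cell n.+1 (j.*2).-1 \/ r \in dyadic_cell n.+1 j.*2.
Proof.
case: j => // j _; rewrite /dyadic_cell !in_itv /= => /andP[].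
have -> : 2 ^- n = 2 * 2 ^- n.+1 :> R.
  by rewrite exprS invfM mulVKf.
rewrite doubleS /= -[j.*2.+2]addn2 -[j.*2.+1]addn1 -[j.+1]addn1.
rewrite -addnn !natrD.
have : 0 < 2 ^- n.+1 :> R by rewrite invr_gt0 exprn_gt0.
move: (2 ^- n.+1) => t t0 h1 h2.
(* Here j is one less than the index of the cell, so the midpoint is (2j + 1) t. *)
have [h|h] := leP r ((2 * j%:R + 1) * t); [left|right];
  by apply/andP; split; lra.
Qed.

(* A level of generation n lies in one of the two halves of its cell and is
   reused there at generation n + 1; the other half gets a new level. *)
Lemma nested_levels (P : R -> Prop) :
  (forall a b : R, 0 <= a -> a < b -> exists y : R, [/\ a < y, y <= b & P y]) ->
  exists y : nat -> nat -> R, forall n j, (0 < j)%N ->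
    [/\ y n j \in dyadic_cell n j, P (y n j)
      & exists2 i, (0 < i <= j.*2)%N & y n.+1 i = y n j].
Proof.
move=> HP.
have /choice[p pP] : forall nj : nat * nat, exists r, (0 < nj.2)%N ->
    r \in dyadic_cell nj.1 nj.2 /\ P r.
  move=> [n [|j]]; first by exists 0.
  have t0 : 0 < 2 ^- n :> R by rewrite invr_gt0 exprn_gt0.
  have [||r [r1 r2 Pr]] := HP ((j.+1%:R - 1) * 2 ^- n) (j.+1%:R * 2 ^- n).
  - by rewrite -natr1 addrK mulr_ge0 // ltW.
  - by rewrite ltr_pM2r // gtrBl.
  - by exists r => _; rewrite /dyadic_cell in_itv /= r1 r2.
(* [uphalf j] is the index of the parent cell. Levels are built for every j > 0, with no upper
   limit, so a parent level always exists. *)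
pose fix y (n j : nat) {struct n} : R := if n is m.+1 then
  if y m (uphalf j) \in dyadic_cell n j then y m (uphalf j) else p (n, j)
  else p (0%N, j).
have yP n : forall j, (0 < j)%N -> y n j \in dyadic_cell n j /\ P (y n j).
  elim: n => [|n IH] j j0; first exact: pP (0%N, j) j0.
  rewrite /=; case: ifPn => [h|_]; last exact: pP (n.+1, j) j0.
  by split=> //; apply: (IH _ _).2; rewrite uphalf_gt0.
exists y => n j j0; have [yc yg] := yP n j j0; split => //.
have [h|h] := dyadic_cell_split j0 yc.
  exists (j.*2).-1; first by lia.
  have /= -> : uphalf (j.*2).-1 = j by lia.
  by rewrite h.
exists j.*2; first by lia.
by rewrite /= uphalf_double h.
Qed.

End LevelSums.

(** * Approximation over the completion and admissible levels *)

Section Approximation.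
Context (R : realType) (X : Type) (A : set (set X)) (mu : set X -> R).
Hypotheses (hA : is_field_of_sets A) (hmu : is_charge A mu).
Local Notation omu := (outer_charge A mu).
Local Notation PJ := (peano_jordan A mu).

Lemma charge_bigsetU_le (I : Type) (s : seq I) (B : I -> set X) :
  (forall i, A (B i)) ->
  mu (\big[setU/set0]_(i <- s) B i) <= \sum_(i <- s) mu (B i).
Proof.
move=> aB; elim: s => [|i s IH].
  by rewrite !big_nil; case: hmu => ->.
rewrite !big_cons; apply: le_trans (lerD (lexx _) IH).
by apply: (charge_setU_le hA hmu) => //; apply: (field_bigsetU hA).
Qed.

(** Each fibre is shrunk to an inner set in [A] and the remainder gets the value 0. The two
    functions can differ only on the finitely many gaps between inner and outer sets. *)
Lemma simple_function_peano_jordan (g : X -> R) (e : R) : 0 < e ->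
  simple_function PJ g -> exists2 g', simple_function A g' &
    omu [set x | g x <> g' x] < e.
Proof.
move=> e0 /(simple_functionP (peano_jordan_field hA hmu))[T [h [c [Ph ->]]]].
(* The successor makes the total of the gaps strictly less than e, even for empty [T]. *)
pose d := e / #|T|.+1%:R.
have d0 : 0 < d by rewrite divr_gt0.
have /choice[BC BCP] : forall t, exists BC : set X * set X,
    [/\ A BC.1, A BC.2, BC.1 `<=` h @^-1` [set t], h @^-1` [set t] `<=` BC.2
      & mu (BC.2 `\` BC.1) < d].
  by move=> t; have [B [C BC]] := Ph t d d0; exists (B, C).
pose U t := (BC t).2 `\` (BC t).1.
have aU t : A (U t) by case: (BCP t) => *; exact: field_setD.
pose h' x := if x \in (BC (h x)).1 then Some (h x) else None.
have hS t : h' @^-1` [set Some t] = (BC t).1.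
  apply/seteqP; split=> x /=; rewrite /h'.
    by case: ifPn => // /set_mem + [<-].
  by case: (BCP t) => _ _ + _ _ Bx => /(_ x Bx) /= ->; rewrite mem_set.
(* The remainder is the complement of a finite union of sets of [A], hence itself in [A]. *)
have hN : h' @^-1` [set None] = ~` \big[setU/set0]_t h' @^-1` [set Some t].
  rewrite -bigcup_seq; apply/seteqP; split=> x /=.
    by move=> + [t _ /=] => ->.
  case E: (h' x) => [t|//] nU; exfalso; apply: nU.
  by exists t => //=; rewrite mem_index_enum.
have Fh' t : A (h' @^-1` [set t]).
  case: t => [t|]; first by rewrite hS; case: (BCP t).
  by rewrite hN; apply: field_setC => //; apply: (field_bigsetU hA) => // t _;
    rewrite hS; case: (BCP t).
exists (oapp c 0 \o h').
  by apply/(simple_functionP hA); exists (option T), h', (oapp c 0).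
apply: (@le_lt_trans _ _ (mu (\big[setU/set0]_t U t))).
  apply: outer_charge_le => //; first by apply: (field_bigsetU hA).
  move=> x /= neq; rewrite -bigcup_seq; exists (h x).
    by rewrite /= mem_index_enum.
  case: (BCP (h x)) => _ _ _ hC _; split; first exact: hC.
  by move=> Bx; apply: neq; rewrite /h' mem_set.
apply: le_lt_trans (charge_bigsetU_le _ aU) _.
apply: (@le_lt_trans _ _ (\sum_(t : T) d)).
  by apply: ler_sum => t _; apply: ltW; case: (BCP t).
rewrite sumr_const -mulr_natr /d -mulrA gtr_pMr // mulrC ltr_pdivrMr //.
by rewrite mul1r ltr_nat.
Qed.

Lemma L0_peano_jordan (f : X -> R) (f_ : nat -> X -> R) :
  (forall n, (0 < n)%N -> simple_function PJ (f_ n)) ->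
  hazy_cvg A mu f_ f -> L0 A mu f.
Proof.
move=> Sf /(hazy_cvgP hA hmu) cf; apply/(L0P hA hmu) => e e0.
have e20 : 0 < e / 2 by rewrite divr_gt0.
have [N _ HN] := cf _ e20.
(* The successor avoids index 0, where the function need not be simple. *)
have fN := HN N.+1 (leqnSn N).
have [g Sg gN] := simple_function_peano_jordan e20 (Sf N.+1 isT).
exists g => //; rewrite [ltRHS](splitr e).
apply: (outer_charge_lt_setU hA hmu _ fN gN) => x /= ex.
have [fg|neq] := eqVneq (f_ N.+1 x) (g x); last by right; apply/eqP.
by left; rewrite /= fg; lra.
Qed.

Lemma smooth_funrpos (f : X -> R) : smooth A mu f -> smooth A mu f^\+.
Proof.
move=> Sf e e0; have [k k0 Hk] := Sf e e0; exists k => //.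
apply: le_lt_trans Hk; apply: le_outer_charge => // x /=.
have := ler_norm (f x); have := normr_ge0 (f x).
by rewrite /funrpos; case: (lerP (f x) 0) => ? ? ?; rewrite ger0_norm; lra.
Qed.

Lemma smooth_opp (f : X -> R) : smooth A mu f -> smooth A mu (\- f).
Proof.
by move=> Sf e /Sf[k k0 Hk]; exists k => //; under eq_set do rewrite normrN.
Qed.

(** For large n the error exceeds e only above the top level. That level is greater than n - 2^-n,
    hence than the k given by smoothness. *)
Lemma hazy_cvg_level_sum (g : X -> R) (y : nat -> nat -> R) :
  (forall x, 0 <= g x) -> smooth A mu g ->
  (forall n j, (0 < n)%N -> (1 <= j <= nlevels n)%N ->
     y n j \in dyadic_cell R n j) ->
  hazy_cvg A mu (fun n => level_sum (nlevels n) (y n) g) g.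
Proof.
move=> g0 Sg yc; apply/(hazy_cvgP hA hmu) => e e0.
have e20 : 0 < e / 2 by rewrite divr_gt0.
have [k k0 Hk] := Sg e e0; near=> n.
have n0 : (0 < n)%N by near: n; exact: nbhs_infty_gt.
have nk : k + 1 < n%:R by near: n; exact: nbhs_infty_gtr.
have ne : n.+1%:R^-1 < e / 2.
  by near: n; exact: near_infty_natSinv_lt (PosNum e20).
set K := nlevels n; have K0 : (0 < K)%N by rewrite muln_gt0 n0 expn_gt0.
set t : R := 2 ^- n.
have t0 : 0 < t by rewrite invr_gt0 exprn_gt0.
have te : t < e / 2.
  apply: le_lt_trans ne; rewrite lef_pV2 ?posrE ?exprn_gt0 //.
  by rewrite -natrX ler_nat ltn_expl.
have t1 : t <= 1 by rewrite invf_le1 ?exprn_gt0 // exprn_ege1 // ler1n.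
have yE j : (1 <= j <= K)%N -> (j%:R - 1) * t < y n j /\ y n j <= j%:R * t.
  by move=> jK; have := yc n j n0 jK; rewrite in_itv /= => /andP[].
have KE : K%:R * t = n%:R.
  by rewrite /K /nlevels natrM natrX mulfK // expf_neq0.
have yK : k < y n K.
  have [] := yE K; first by rewrite K0 leqnn.
  by rewrite mulrBl KE mul1r; lra.
apply: le_lt_trans Hk; apply: le_outer_charge => // x /= ex.
rewrite ger0_norm //; apply: lt_le_trans yK _; rewrite leNgt; apply/negP => gy.
(* Levels in adjacent cells can be almost two cell widths apart, whence 2t. *)
have [|j jK|_ /(_ (ltW gy))] :=
  @level_sum_approx _ _ K (y n) g (2 * t) x K0 _ _ (g0 x).
- have [] := yE 1%N; first by rewrite K0.
  by rewrite subrr mul0r mul1r => *; apply/andP; split; lra.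
- have [|a1 a2] := yE j; first by lia.
  have [|b1 b2] := yE j.+1; first by lia.
  rewrite -natr1 addrK mulrDl mul1r in b1 b2.
  by rewrite mulrBl mul1r in a1; apply/andP; split; lra.
by move=> /andP[h1 h2]; move: ex; rewrite distrC ger0_norm //; lra.
Unshelve. all: by end_near. Qed.

(** Off the jumps of [G], {f >= y} lies between {f > u}, with u outside [C] slightly above y, and {f
    > y - d}, whose outer charges nearly agree. *)
Lemma peano_jordan_ge (f : X -> R) (C : set R) : countable C ->
  (forall y, ~ C y -> PJ [set x | y < f x]) ->
  exists D : set R, countable D /\ forall y, ~ D y -> PJ [set x | y <= f x].
Proof.
move=> cC Cf; pose G y := omu [set x | y < f x].
have Gmono : {homo G : x y / x <= y >-> y <= x}.
  by move=> y z yz; apply: le_outer_charge => // x /=; exact: le_lt_trans.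
have [D [cD DP]] := countable_jumps Gmono.
exists D; split=> // y Dy; apply: peano_jordan_sandwich => // e e0.
have [d d0 Gd] := DP y Dy e e0.
have [u [yu ud Cu]] := @countable_setC_itv _ C y (y + d) cC ltac:(lra).
exists [set x | u < f x], [set x | y - d < f x]; split.
- exact: Cf.
- by move=> x /=; lra.
- by move=> x /=; lra.
- by have : G (y + d) <= G u; [apply: Gmono; lra|rewrite /G in Gd *; lra].
Qed.

(** For y > 0, {f^+ > y} is {f > y} and {f^- > y} is the complement of {f >= -y}. So y has to avoid
    [C] and the reflection of [D], together still countable. *)
Lemma common_level (f : X -> R) (C : set R) (a b : R) : countable C ->
  (forall y, ~ C y -> PJ [set x | y < f x]) -> 0 <= a -> a < b ->
  exists y, [/\ a < y, y <= b &
    PJ (f^\+ @^-1` `]y, +oo[) /\ PJ (f^\- @^-1` `]y, +oo[)].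
Proof.
move=> cC Cf a0 ab; have [D [cD Df]] := peano_jordan_ge cC Cf.
have cE : countable (C `|` -%R @` D).
  rewrite -bigcup2E; apply: bigcup_countable => // -[|[|i]] _ //=.
  by apply: sub_countable cD; exact: card_image_le.
have [y [ay yb /not_orP[Cy Dy]]] := countable_setC_itv cE ab.
exists y; split=> //; first exact: ltW.
have y0 : 0 < y by lra.
rewrite !preimage_itvoy; split.
  rewrite (_ : [set _ | _] = [set x | y < f x]); first exact: Cf.
  by apply/seteqP; split=> x /=; rewrite lt_max [y < 0]ltNge (ltW y0) orbF.
rewrite (_ : [set _ | _] = ~` [set x | - y <= f x]).
  apply: (field_setC (peano_jordan_field hA hmu)).
  by apply: Df => Dny; apply: Dy; exists (- y); rewrite ?opprK.
apply/seteqP; split=> x /=; rewrite lt_max [y < 0]ltNge (ltW y0) orbF ltrNr.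
  by move=> h; apply/negP; rewrite -ltNge.
by move/negP; rewrite -ltNge.
Qed.

End Approximation.

(** * Measurability, superlevel sets and dyadic approximation: the cycle of implications *)

Theorem theorem20 (R : realType) (X : Type) (A : set (set X))
    (mu : set X -> R) (hA : is_field_of_sets A) (hmu : is_charge A mu)
    (f : X -> R) :
  [<-> L0 A mu f
     ; (exists C : set R, countable C /\
          forall y : R, ~ C y -> peano_jordan A mu (f @^-1` `]y, +oo[))
       /\ smooth A mu f
     ; exists (fp fm : nat -> X -> R) (y : nat -> nat -> R),
         (forall n, (0 < n)%N ->
            [/\ simple_function (peano_jordan A mu) (fp n),
                simple_function (peano_jordan A mu) (fm n),
                fp n = level_sum (nlevels n) (y n) f^\+
              & fm n = level_sum (nlevels n) (y n) f^\-])
         /\ [/\ forall n j, (0 < n)%N -> (1 <= j <= nlevels n)%N ->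
                  y n j \in `](j%:R - 1) * 2 ^- n, j%:R * 2 ^- n],
                forall n j, (0 < n)%N -> (1 <= j <= nlevels n)%N ->
                  peano_jordan A mu (f^\+ @^-1` `]y n j, +oo[) /\
                  peano_jordan A mu (f^\- @^-1` `]y n j, +oo[),
                forall n, (0 < n)%N ->
                  [set y n j | j in [set j | (1 <= j <= nlevels n)%N]] `<=`
                  [set y n.+1 j | j in [set j | (1 <= j <= nlevels n.+1)%N]]
              & hazy_cvg A mu fp f^\+ /\ hazy_cvg A mu fm f^\-]].
Proof.
tfae.
- by move=> Lf; split; [exact: L0_superlevel|exact: L0_smooth].
- move=> [[C [cC Cf]] Sf].
  have [|y yP] := @nested_levels R (fun y =>
    peano_jordan A mu (f^\+ @^-1` `]y, +oo[) /\
    peano_jordan A mu (f^\- @^-1` `]y, +oo[)).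
    move=> a b; apply: (common_level hA hmu cC) => z /Cf.
    by rewrite preimage_itvoy.
  have nlevels_gt0 n : (0 < n)%N -> (0 < nlevels n)%N.
    by move=> n0; rewrite muln_gt0 n0 expn_gt0.
  have PJ := peano_jordan_field hA hmu.
  exists (fun n => level_sum (nlevels n) (y n) f^\+),
    (fun n => level_sum (nlevels n) (y n) f^\-), y.
  split=> [n n0|]; split=> //.
  + apply: simple_function_level_sum => //; first exact: nlevels_gt0.
    by move=> j /andP[j0 _]; have [_ [+ _] _] := yP n j j0.
  + apply: simple_function_level_sum => //; first exact: nlevels_gt0.
    by move=> j /andP[j0 _]; have [_ [_ +] _] := yP n j j0.
  + by move=> n j _ /andP[j0 _]; have [] := yP n j j0.
  + by move=> n j _ /andP[j0 _]; have [] := yP n j j0.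
  + move=> n n0 _ [j /= /andP[j0 jK] <-].
    have [_ _ [i iP <-]] := yP n j j0; exists i => //=.
    (* The reused level has new index at most 2j, and 2 n 2^n is at most (n + 1) 2^(n + 1). *)
    case/andP: iP => -> /= /leq_trans; apply.
    rewrite /nlevels in jK *; rewrite expnS mulnCA mul2n leq_double.
    by apply: (leq_trans jK); rewrite leq_mul2r leqnSn orbT.
  + have yc n j (_ : (0 < n)%N) (jK : (1 <= j <= nlevels n)%N) :
        y n j \in dyadic_cell R n j.
      by case/andP: jK => j0 _; have [] := yP n j j0.
    split; apply: (hazy_cvg_level_sum hA hmu) => //.
    * exact: smooth_funrpos.
    * by rewrite -funrposN; apply: smooth_funrpos => //; exact: smooth_opp.
- move=> [fp [fm [y [Hf [_ _ _ [cp cm]]]]]].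
  have Lp : L0 A mu f^\+.
    by apply: (L0_peano_jordan hA hmu _ cp) => n /Hf[].
  have Lm : L0 A mu f^\-.
    by apply: (L0_peano_jordan hA hmu _ cm) => n /Hf[].
  by rewrite -[f]funrposBneg; exact: L0_sub.
Qed.
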